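(* Let $0\le d_1\le d_2$ be integers. The ideal $J'(d_1,d_2)\subseteq\mathbb{C}[t_1,t_2,t_3,x_1,x_2,x_3]$ can be written as a product $$J'(d_1,d_2)=J'(1,1)^{d_1}\cdot J'(0,1)^{d_2-d_1}.$$
   Context: For integers $0\le e_1\le e_2$, $$J'(e_1,e_2)=(t_1-t_2,x_1-x_2)^{e_1}\cap(t_1-t_3,x_1-x_3)^{e_1}\cap(t_2-t_3,x_2-x_3)^{e_2}\subseteq\mathbb{C}[t_1,t_2,t_3,x_1,x_2,x_3],$$ where the zeroth power of an ideal is the whole ring. *)

(* Defs.v *)
From mathcomp Require Import all_boot all_algebra.
From mathcomp Require Import classical_sets reals complex mpoly.

Set Implicit Arguments.
Unset Strict Implicit.
Unset Printing Implicit Defensive.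

Import GRing.Theory.
Local Open Scope ring_scope.
Local Open Scope complex_scope.
Local Open Scope classical_set_scope.

(* The unit ideal is allowed, unlike in ring_quotient's [idealr_closed]. *)
Definition is_ideal (A : comNzRingType) (I : set A) : Prop :=
  [/\ I 0,
      (forall a b, I a -> I b -> I (a + b))
    & (forall c a, I a -> I (c * a))].

Definition ideal_gen (A : comNzRingType) (S : set A) : set A :=
  smallest (@is_ideal A) S.

Definition ideal_mul (A : comNzRingType) (I J : set A) : set A :=
  ideal_gen [set a * b | a in I & b in J].

Definition ideal_pow (A : comNzRingType) (I : set A) (n : nat) : set A :=
  iter n (ideal_mul I) setT.

(* C[t_1, t_2, t_3, x_1, x_2, x_3], with C = R[i] for the real numbers R; the
   variables with index below 3 are the t_i, the remaining ones the x_i. *)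
Notation polytx R := {mpoly R[i][3 + 3]}.

(* The indices 1, 2, 3 of the variables are 0, 1, 2 in ['I_3]. *)
Definition tvar (R : realType) (k : 'I_3) : polytx R := 'X_(lshift 3 k).
Definition xvar (R : realType) (k : 'I_3) : polytx R := 'X_(rshift 3 k).

Definition diag_ideal (R : realType) (k l : 'I_3) : set (polytx R) :=
  ideal_gen [set tvar R k - tvar R l; xvar R k - xvar R l].
Arguments diag_ideal : clear implicits.

Definition J' (R : realType) (e1 e2 : nat) : set (polytx R) :=
  ideal_pow (diag_ideal R 0 1) e1
  `&` ideal_pow (diag_ideal R 0 2%:R) e1
  `&` ideal_pow (diag_ideal R 1 2%:R) e2.
Arguments J' : clear implicits.

(* Main.v *)
Require Import Defs.
From HB Require Import structures.
From mathcomp Require Import all_boot all_algebra.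
From mathcomp Require Import classical_sets reals complex mpoly.
From mathcomp Require Import ring zify.

Set Implicit Arguments.
Unset Strict Implicit.
Unset Printing Implicit Defensive.

Import GRing.Theory.
Local Open Scope ring_scope.
Local Open Scope complex_scope.
Local Open Scope classical_set_scope.

(** Write [p_i = (t_i, x_i)] for the three points of the plane whose coordinates
    are the variables, [I_ij] for the ideal of the diagonal [p_i = p_j], and
    [D] ([cross] below) for the determinant of [p_1 - p_3] and [p_2 - p_3],
    which vanishes exactly when the three points are collinear. The theorem
    is the equality of [J'(m, m + k) = I_12^m cap I_13^m cap I_23^(m + k)]
    with [J'(1,1)^m I_23^k]; only the inclusion of the first in the second is
    not formal, and it goes by induction on [m].

    Restrict [f] in [J'(m, m + k)] to the collinear triples, parametrized as
    [p_1 = p_3 + a (u, v)], [p_2 = p_3 + b (u, v)] (the morphism [collinear]).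
    There [I_12], [I_13] and [I_23] become divisible by [a - b], [a] and [b],
    which are pairwise coprime, so the restriction is a multiple of
    [E = ((a - b) a b)^m b^k] ([collinear_J]). It also has the same degree in
    [(u, v)] as in [(a, b)]. Hence the cofactor of [E] is a sum of monomials
    with enough factors [u], [v] to give one of them to each linear factor of
    [E]: every term is the restriction of a product of coordinate differences
    [t_i - t_j] (for the factors [u]) and [x_i - x_j] (for the factors [v]).
    Thus the restriction of [f] is also that of some [f_0] in
    [J'(1,1)^m I_23^k] ([lifts_multiple]).

    Now [f - f_0] vanishes on collinear triples, so [f - f_0 = g D]
    ([collinear_ker]). As [D] vanishes to order exactly one along each
    diagonal, and orders of vanishing are additive, [g] lies in
    [J'(m - 1, m - 1 + k)] ([diag_pow_cross]), hence in
    [J'(1,1)^(m - 1) I_23^k] by induction; and [D] is in [J'(1,1)]. *)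

(** * Ideals and their powers *)

Section Ideals.
Variable A : comNzRingType.
Implicit Types (I J K : set A) (a b e : A).

Lemma ideal0 I : is_ideal I -> I 0.
Proof. by case. Qed.

Lemma idealD I a b : is_ideal I -> I a -> I b -> I (a + b).
Proof. by case=> _ ID _; apply: ID. Qed.

Lemma idealMl I c a : is_ideal I -> I a -> I (c * a).
Proof. by case=> _ _ IM; apply: IM. Qed.

Lemma idealB I a b : is_ideal I -> I a -> I b -> I (a - b).
Proof. by move=> II Ia Ib; rewrite -mulN1r; apply: idealD => //; apply: idealMl. Qed.

Lemma ideal_sum I (T : Type) (r : seq T) (P : pred T) (F : T -> A) :
  is_ideal I -> (forall i, P i -> I (F i)) -> I (\sum_(i <- r | P i) F i).
Proof. by case=> I0 ID _ IF; elim/big_ind: _ => // a b; apply: ID. Qed.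

Lemma ideal_setT : is_ideal (@setT A).
Proof. by []. Qed.

Lemma ideal_setI I J : is_ideal I -> is_ideal J -> is_ideal (I `&` J).
Proof.
case=> I0 ID IM [J0 JD JM]; split=> [//|a b [Ia Ja] [Ib Jb]|c a [Ia Ja]].
  by split; [exact: ID|exact: JD].
by split; [exact: IM|exact: JM].
Qed.

Lemma ideal_colon I c : is_ideal I -> is_ideal [set a | I (a * c)].
Proof.
case=> I0 ID IM; split=> [|a b Ia Ib|d a Ia] /=; first by rewrite mul0r.
  by rewrite mulrDl; apply: ID.
by rewrite -mulrA; apply: IM.
Qed.

Lemma ideal_gen_ideal (S : set A) : is_ideal (ideal_gen S).
Proof.
split=> [I [[]] //|a b Sa Sb I IS|c a Sa I IS]; case: (IS) => -[_ ID IM] _.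
  by apply: ID; [apply: Sa|apply: Sb].
by apply: IM; apply: Sa.
Qed.

Lemma ideal_mul_ideal I J : is_ideal (ideal_mul I J).
Proof. exact: ideal_gen_ideal. Qed.

Lemma ideal_pow_ideal I n : is_ideal (ideal_pow I n).
Proof. by case: n => [|n]; [exact: ideal_setT|exact: ideal_mul_ideal]. Qed.

Lemma mem_ideal_mul I J a b : I a -> J b -> ideal_mul I J (a * b).
Proof. by move=> Ia Jb; apply: sub_gen_smallest; exists a => //; exists b. Qed.

Lemma ideal_mul_min I J K : is_ideal K ->
  (forall a b, I a -> J b -> K (a * b)) -> ideal_mul I J `<=` K.
Proof. by move=> KI IJK; apply: smallest_sub => // _ [a Ia [b Jb <-]]; apply: IJK. Qed.

Lemma ideal_pow_mono I J n : I `<=` J -> ideal_pow I n `<=` ideal_pow J n.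
Proof.
move=> IJ; elim: n => [//|n IHn]; apply: ideal_mul_min => [|a b Ia Ib].
  exact: ideal_pow_ideal.
by apply: mem_ideal_mul; [exact: IJ|exact: IHn].
Qed.

Lemma ideal_pow1 I : is_ideal I -> ideal_pow I 1 = I.
Proof.
move=> II; apply/seteqP; split=> [|a Ia].
  by apply: ideal_mul_min => // a b Ia _; rewrite mulrC; apply: idealMl.
by rewrite -[a]mulr1; apply: mem_ideal_mul.
Qed.

Lemma ideal_powD I m n a b :
  ideal_pow I m a -> ideal_pow I n b -> ideal_pow I (m + n) (a * b).
Proof.
elim: m a => [|m IHm] a Ia Ib.
  by apply: idealMl => //; apply: ideal_pow_ideal.
pose K := [set a | ideal_pow I (m.+1 + n) (a * b)].
move: a Ia; apply: (@ideal_mul_min _ _ K) => [|a c Ia Ic].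
  exact/ideal_colon/ideal_pow_ideal.
by rewrite /K /= -mulrA; apply: mem_ideal_mul => //; apply: IHm.
Qed.

Lemma ideal_pow_le I m n : (m <= n)%N -> ideal_pow I n `<=` ideal_pow I m.
Proof.
move=> /subnKC <-; elim: (n - m)%N => [|k IHk]; first by rewrite addn0.
rewrite addnS; apply: ideal_mul_min => [|a b _ Ib]; first exact: ideal_pow_ideal.
by apply: idealMl; [apply: ideal_pow_ideal|apply: IHk].
Qed.

Definition principal e : set A := [set a | exists c, a = c * e].

Lemma principal_ideal e : is_ideal (principal e).
Proof.
split=> [|_ _ [c ->] [d ->]|d _ [c ->]]; first by exists 0; rewrite mul0r.
  by exists (c + d); rewrite mulrDl.
by exists (d * c); rewrite mulrA.
Qed.

Lemma ideal_preim (B : comNzRingType) (f : {rmorphism A -> B}) (I : set B) :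
  is_ideal I -> is_ideal (f @^-1` I).
Proof.
case=> I0 ID IM; split=> [|a b|c a] /=; rewrite ?rmorph0 // ?rmorphD ?rmorphM.
  exact: ID.
exact: IM.
Qed.

End Ideals.

Lemma ideal_pow_principal (A B : comNzRingType) (f : {rmorphism A -> B})
    (I : set A) (e : B) n :
  (forall a, I a -> principal e (f a)) ->
  forall a, ideal_pow I n a -> principal (e ^+ n) (f a).
Proof.
move=> Ie; elim: n => [|n IHn] a; first by exists (f a); rewrite mulr1.
pose K := f @^-1` principal (e ^+ n.+1).
move: a; apply: (@ideal_mul_min _ _ _ K) => [|a b /Ie[c fa] /IHn[d fb]].
  exact/ideal_preim/principal_ideal.
by exists (c * d); rewrite rmorphM fa fb exprS; ring.
Qed.


(** * Cancellation of prime powers *)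

(** [ev] plays the role of reduction modulo [l]: its hypotheses make the kernel
    of [ev] the ideal [(l)], which is therefore prime, and [c] is not in it. *)
Lemma principal_pow_cancel (S : idomainType) (ev : {rmorphism S -> S}) (l c : S) m g h :
  (forall f, principal l (f - ev f)) -> ev l = 0 -> ev c != 0 ->
  c * g = h * l ^+ m -> principal (l ^+ m) g.
Proof.
move=> evP evl evc; elim: m g h => [|m IHm] g h; first by exists g; rewrite mulr1.
move=> cg; have [l0|l0] := eqVneq l 0.
  suff -> : g = 0 by exists 0; rewrite mul0r.
  apply/eqP; move/eqP: cg; rewrite l0 expr0n mulr0 mulf_eq0 => /orP[/eqP c0|//].
  by rewrite c0 rmorph0 eqxx in evc.
have evg : ev g = 0.
  apply/eqP; have /eqP := congr1 ev cg.
  by rewrite !rmorphM rmorphXn evl expr0n mulr0 mulf_eq0 (negPf evc).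
have [y] := evP g; rewrite evg subr0 => gE.
have [z yE] : principal (l ^+ m) y.
  apply: (IHm y h); apply: (mulIf l0).
  by rewrite -mulrA -gE cg exprSr mulrA.
by exists z; rewrite gE yE exprSr mulrA.
Qed.

Lemma mulIf_shift (S : idomainType) (a b e z : S) :
  e != 0 -> a * e = b * (e * z) -> a = b * z.
Proof. by move=> e0 ae; apply: (mulIf e0); rewrite ae mulrA mulrAC. Qed.

Section EdgeFactor.
Variables S T : comNzRingType.
Implicit Types (a b z : S) (m k : nat).

(** For points at the positions [a], [b] and [0] of a line, the product of the
    three distances to the power [m], times the power [k] of the last one: what
    every element of [J'(m, m + k)] is divisible by on such triples. *)
Definition edge_factor (S : comNzRingType) (a b : S) m k :=
  ((a - b) * a * b) ^+ m * b ^+ k.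

Lemma rmorph_edge_factor (f : {rmorphism S -> T}) a b m k :
  f (edge_factor a b m k) = edge_factor (f a) (f b) m k.
Proof. by rewrite /edge_factor rmorphM !rmorphXn !rmorphM rmorphB. Qed.

Lemma edge_factorE a b m k :
  (a - b) ^+ m * a ^+ m * b ^+ (m + k) = edge_factor a b m k.
Proof. by rewrite /edge_factor !exprMn [b ^+ (m + k)]exprD !mulrA. Qed.

Lemma edge_factor_scale a b z m k :
  edge_factor (a * z) (b * z) m k = edge_factor a b m k * z ^+ (m * 3 + k).
Proof. by rewrite /edge_factor -mulrBl [z ^+ _]exprD mulnC exprM !exprMn; ring. Qed.
End EdgeFactor.

(** * Polynomial functions of three points of the plane *)

Section Points.
Variable R : realType.
Local Notation A := (polytx R).
Local Notation t := (@tvar R).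
Local Notation x := (@xvar R).
Local Notation t1 := (tvar R 0).
Local Notation t2 := (tvar R 1).
Local Notation t3 := (tvar R 2%:R).
Local Notation x1 := (xvar R 0).
Local Notation x2 := (xvar R 1).
Local Notation x3 := (xvar R 2%:R).

Lemma polytx_ind (P : A -> Prop) :
  (forall c, P c%:MP) -> (forall k, P (t k)) -> (forall k, P (x k)) ->
  (forall f g, P f -> P g -> P (f + g)) ->
  (forall f g, P f -> P g -> P (f * g)) -> forall f, P f.
Proof.
move=> PC Pt Px PD PM; elim/mpolyind => [|c m f _ _ Pf]; first by rewrite -mpolyC0.
apply: PD => //; rewrite -mul_mpolyC mpolyXE_id; apply: (PM) => //.
apply: big_ind => [|//|i _]; first by rewrite -mpolyC1.
elim: (m i) => [|e IHe]; first by rewrite expr0 -mpolyC1.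
rewrite exprS; apply: (PM) => //; rewrite -(splitK i).
by case: (split i) => k; [exact: Pt|exact: Px].
Qed.

Lemma rmorph_congr (S : comNzRingType) (I : set S) (g1 g2 : {rmorphism A -> S}) :
  is_ideal I -> (forall c, g1 c%:MP = g2 c%:MP) ->
  (forall k, I (g1 (t k) - g2 (t k))) -> (forall k, I (g1 (x k) - g2 (x k))) ->
  forall f, I (g1 f - g2 f).
Proof.
move=> [I0 ID IM] gC gt gx; apply: polytx_ind => // [c|f g If Ig|f g If Ig].
- by rewrite gC subrr.
- by rewrite !rmorphD opprD addrACA; apply: ID.
rewrite !rmorphM [X in I X](_ : _ = g1 g * (g1 f - g2 f) + g2 f * (g1 g - g2 g)).
  by apply: ID; apply: IM.
by ring.
Qed.

Lemma ord3P (P : 'I_3 -> Prop) : P 0 -> P 1 -> P 2%:R -> forall k, P k.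
Proof.
move=> P0 P1 P2 [[|[|[|k]]] lt_k] //; [have := P0|have := P1|have := P2];
  by congr P; apply: val_inj.
Qed.

Definition triple (S : nzRingType) (a b c : S) (k : 'I_3) : S := [:: a; b; c]`_k.

(** A ring morphism out of the polynomial ring is used only through its values on
    constants and variables, so its construction as a sum over monomials is
    sealed. *)
Fact at_points_subproof (S : comNzRingType) (cst : {rmorphism R[i] -> S})
    (tau xi : 'I_3 -> S) :
  {f : {rmorphism A -> S} | [/\ forall c, f c%:MP = cst c,
    forall k, f (t k) = tau k & forall k, f (x k) = xi k]}.
Proof.
pose v i := match split i with inl k => tau k | inr k => xi k end.
exists (mmap cst v : {rmorphism A -> S}); split=> [c|k|k] /=; first exact: mmapC.
  by rewrite /tvar mmapX mmap1U /v -/(unsplit (inl k)) unsplitK.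
by rewrite /xvar mmapX mmap1U /v -/(unsplit (inr k)) unsplitK.
Qed.

Definition at_points (S : comNzRingType) (cst : {rmorphism R[i] -> S}) tau xi :
  A -> S := sval (@at_points_subproof S cst tau xi).
HB.instance Definition _ (S : comNzRingType) (cst : {rmorphism R[i] -> S}) tau xi :=
  GRing.RMorphism.on (@at_points S cst tau xi).

Lemma at_pointsC S cst tau xi c : @at_points S cst tau xi c%:MP = cst c.
Proof. by rewrite /at_points; case: at_points_subproof => f []. Qed.

Lemma at_pointst S cst tau xi k : @at_points S cst tau xi (t k) = tau k.
Proof. by rewrite /at_points; case: at_points_subproof => f []. Qed.

Lemma at_pointsx S cst tau xi k : @at_points S cst tau xi (x k) = xi k.
Proof. by rewrite /at_points; case: at_points_subproof => f []. Qed.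

(** * Powers of a diagonal ideal, by contraction onto the diagonal *)

(** The points with index in [K] are moved to [p_l + 'X (p_k - p_l)], so that
    ['X = 1] is the given configuration and ['X = 0] has them all at [p_l]. For
    [K = {k}] the coefficient of ['X^j] is the part of degree [j] of a polynomial
    in the differences [p_k - p_l], which makes the order of vanishing along
    the diagonal a valuation in ['X]. *)
Definition contract (K : pred 'I_3) (l : 'I_3) : A -> {poly A} :=
  at_points (polyC \o @mpolyC _ _)
    (fun k => if K k then (t l)%:P + (t k - t l)%:P * 'X else (t k)%:P)
    (fun k => if K k then (x l)%:P + (x k - x l)%:P * 'X else (x k)%:P).
HB.instance Definition _ K l := GRing.RMorphism.on (contract K l).

Lemma contractC K l c : contract K l c%:MP = (c%:MP)%:P.
Proof. exact: at_pointsC. Qed.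

Lemma contractt K l k :
  contract K l (t k) = if K k then (t l)%:P + (t k - t l)%:P * 'X else (t k)%:P.
Proof. exact: at_pointst. Qed.

Lemma contractx K l k :
  contract K l (x k) = if K k then (x l)%:P + (x k - x l)%:P * 'X else (x k)%:P.
Proof. exact: at_pointsx. Qed.

Lemma contract1 K l f : (contract K l f).[1] = f.
Proof.
elim/polytx_ind: f => [c|k|k|f g ff gg|f g ff gg].
- by rewrite contractC hornerC.
- rewrite contractt; case: ifP => _; last by rewrite hornerC.
  by rewrite hornerD hornerMX !hornerC mulr1 subrKC.
- rewrite contractx; case: ifP => _; last by rewrite hornerC.
  by rewrite hornerD hornerMX !hornerC mulr1 subrKC.
- by rewrite (rmorphD (contract K l)) hornerD ff gg.
by rewrite (rmorphM (contract K l)) hornerM ff gg.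
Qed.

Lemma mem_diag_t k l : diag_ideal R k l (t k - t l).
Proof. by apply: sub_gen_smallest; left. Qed.

Lemma mem_diag_x k l : diag_ideal R k l (x k - x l).
Proof. by apply: sub_gen_smallest; right. Qed.

Lemma diag_ideal_ideal k l : is_ideal (diag_ideal R k l).
Proof. exact: ideal_gen_ideal. Qed.
Arguments diag_ideal_ideal : clear implicits.

Lemma diag_ideal_min k l (I : set A) : is_ideal I ->
  I (t k - t l) -> I (x k - x l) -> diag_ideal R k l `<=` I.
Proof. by move=> II It Ix; apply: smallest_sub => // _ [->|->]. Qed.

Lemma contract_coef k l f j :
  ideal_pow (diag_ideal R k l) j (contract (pred1 k) l f)`_j.
Proof.
have PI n : is_ideal (ideal_pow (diag_ideal R k l) n) by exact: ideal_pow_ideal.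
have lin (a b : A) n : diag_ideal R k l b ->
    ideal_pow (diag_ideal R k l) n (a%:P + b%:P * 'X)`_n.
  move=> Ib; have Ib1 : ideal_pow (diag_ideal R k l) 1 b.
    by rewrite ideal_pow1 //; apply: diag_ideal_ideal.
  rewrite coefD coefC coefMX coefC; case: n => [|[|n]]; rewrite ?add0r ?addr0 //.
  exact: ideal0 (PI _).
have cst (a : A) n : ideal_pow (diag_ideal R k l) n (a%:P)`_n.
  by rewrite coefC; case: n => [//|n]; exact: ideal0 (PI _).
elim/polytx_ind: f j => [c|k'|k'|f g ff gg|f g ff gg] j.
- by rewrite contractC; apply: cst.
- rewrite contractt /=; case: eqP => [->|_]; last exact: cst.
  by apply: lin; apply: mem_diag_t.
- rewrite contractx /=; case: eqP => [->|_]; last exact: cst.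
  by apply: lin; apply: mem_diag_x.
- by rewrite (rmorphD (contract _ l)) coefD; apply: (idealD (PI j)).
rewrite (rmorphM (contract _ l)) coefM; apply: ideal_sum => [|i _]; first exact: PI.
by rewrite -{1}(subnKC (ltnSE (ltn_ord i))); apply: ideal_powD.
Qed.

(** A polynomial is the sum of the coefficients of its contraction, each in the
    corresponding power, so it is enough that the low ones vanish. *)
Lemma diag_powP k l m f : k != l ->
  ideal_pow (diag_ideal R k l) m f <->
  forall j, (j < m)%N -> (contract (pred1 k) l f)`_j = 0.
Proof.
move=> kl; split=> [fP j ltjm|f0].
  pose cD := contract (pred1 k) l.
  have [|c ->] := @ideal_pow_principal _ _ cD (diag_ideal R k l) 'X m _ _ fP.
    apply: (@diag_ideal_min _ _ (contract (pred1 k) l @^-1` principal 'X)).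
    - exact/ideal_preim/principal_ideal.
    - exists (t k - t l)%:P; rewrite /= (rmorphB (contract _ l)) /= !contractt /=.
      by rewrite eqxx eq_sym (negPf kl) addrC addKr.
    - exists (x k - x l)%:P; rewrite /= (rmorphB (contract _ l)) /= !contractx /=.
      by rewrite eqxx eq_sym (negPf kl) addrC addKr.
  by rewrite coefMXn ltjm.
rewrite -(contract1 (pred1 k) l f) horner_coef.
apply: ideal_sum => [|i _]; first exact: ideal_pow_ideal.
rewrite expr1n mulr1; case: (ltnP i m) => [/f0->|le_mi].
  exact: (ideal0 (ideal_pow_ideal _ _)).
by apply: (ideal_pow_le le_mi); apply: contract_coef.
Qed.

(** * The determinant of three points *)

Definition cross : A := (t1 - t3) * (x2 - x3) - (t2 - t3) * (x1 - x3).

(** The determinant is affine in each point and vanishes when two points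
    coincide, so it is linear along a contraction. *)
Lemma contract_cross k l : k != l -> contract (pred1 k) l cross = cross%:P * 'X.
Proof.
move: k l; do 2!apply: ord3P; rewrite ?eqxx // => _;
  rewrite /cross (rmorphB (contract _ _)) !(rmorphM (contract _ _));
  rewrite !(rmorphB (contract _ _)) /= !contractt !contractx /= ?(polyCB, polyCM); ring.
Qed.

(** The values at [p_1 = (1, 0)], [p_2 = (0, 1)], [p_3 = (0, 0)], for showing
    that polynomials are not zero. *)
Definition probe : A -> A := at_points (@mpolyC _ _) (triple 1 0 0) (triple 0 1 0).
HB.instance Definition _ := GRing.RMorphism.on probe.

Lemma probeE : (probe t1 = 1) * (probe t2 = 0) * (probe t3 = 0) *
  (probe x1 = 0) * (probe x2 = 1) * (probe x3 = 0).
Proof. by rewrite /probe !at_pointst !at_pointsx. Qed.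

Lemma probe_neq0 f : probe f = 1 -> f != 0.
Proof. by apply: contra_eq_neq => ->; rewrite (rmorph0 probe) eq_sym oner_neq0. Qed.

Lemma cross_neq0 : cross != 0.
Proof.
apply: probe_neq0; rewrite /cross (rmorphB probe) !(rmorphM probe) !(rmorphB probe) /=.
by rewrite !probeE !subr0 mulr1 mul0r subr0.
Qed.

(** The contraction of [cross] is exactly divisible by ['X], hence multiplying by
    it raises orders of vanishing by exactly one. *)
Lemma diag_pow_cross k l m f : k != l ->
  ideal_pow (diag_ideal R k l) m.+1 (cross * f) -> ideal_pow (diag_ideal R k l) m f.
Proof.
move=> kl /(diag_powP _ _ kl) cf0; apply/(diag_powP _ _ kl) => j ltjm.
have := cf0 j.+1 ltjm.
rewrite (rmorphM (contract _ l)) /= contract_cross // mulrAC coefMX /= coefCM => /eqP.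
by rewrite mulf_eq0 (negPf cross_neq0) => /eqP.
Qed.

Lemma cross_diag k l : k != l -> diag_ideal R k l cross.
Proof.
move=> kl; rewrite -(ideal_pow1 (diag_ideal_ideal k l)).
apply/(diag_powP _ _ kl) => -[|//] _.
by rewrite contract_cross // coefMX.
Qed.

(** * Collinear triples *)

Definition set_t j e : A -> A :=
  at_points (@mpolyC _ _) (fun k => if k == j then e else t k) x.
HB.instance Definition _ j e := GRing.RMorphism.on (set_t j e).

Lemma set_tt j e k : set_t j e (t k) = if k == j then e else t k.
Proof. exact: at_pointst. Qed.

Lemma set_tx j e k : set_t j e (x k) = x k.
Proof. exact: at_pointsx. Qed.

Lemma set_tP j e f : principal (t j - e) (f - set_t j e f).
Proof.
have pI := principal_ideal (t j - e).
apply: (@rmorph_congr _ _ idfun (set_t j e)) => // [c|k|k] /=.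
- by rewrite /set_t at_pointsC.
- rewrite set_tt; case: eqP => [->|_]; first by exists 1; rewrite mul1r.
  by rewrite subrr; apply: ideal0.
by rewrite set_tx subrr; apply: ideal0.
Qed.

(** Restriction to collinear triples, with the target ring reusing the same
    variables: there [(t3, x3)] is the point [p_3], [(x1, x2)] a direction, and
    [t1], [t2] are the positions of [p_1], [p_2] on the line, so that
    [p_1 - p_3 = t1 (x1, x2)] and [p_2 - p_3 = t2 (x1, x2)]. *)
Definition collinear : A -> A :=
  at_points (@mpolyC _ _) (triple (t3 + x1 * t1) (t3 + x1 * t2) t3)
    (triple (x3 + x2 * t1) (x3 + x2 * t2) x3).
HB.instance Definition _ := GRing.RMorphism.on collinear.

(** A rational inverse of [collinear] takes the direction [p_2 - p_3] and the
    positions [(t1 - t3) / (t2 - t3)] and [1]. Multiplying the positions by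
    [t2 - t3] clears the denominator, and the scaling of the direction by ['X]
    keeps track of the degree of the polynomial in [p_1 - p_3], [p_2 - p_3]. *)
Definition chart : A -> {poly A} :=
  at_points (polyC \o @mpolyC _ _)
    (triple (t1 - t3)%:P (t2 - t3)%:P t3%:P)
    (triple ((t2 - t3)%:P * 'X) ((x2 - x3)%:P * 'X) x3%:P).
HB.instance Definition _ := GRing.RMorphism.on chart.

Definition rescale (c : A) : {poly A} -> {poly A} := comp_poly (c%:P * 'X).
HB.instance Definition _ c := GRing.RMorphism.on (rescale c).

Lemma coef_rescale c p j : (rescale c p)`_j = p`_j * c ^+ j.
Proof.
rewrite /rescale /= comp_polyE coef_sum.
rewrite (eq_bigr (fun i : 'I_(size p) => if (i == j :> nat) then p`_j * c ^+ j else 0)).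
  rewrite -big_mkcond /=; case: (ltnP j (size p)) => [lt_j|le_j].
    by rewrite (big_pred1 (Ordinal lt_j)).
  rewrite big1 => [|i /eqP ij]; first by rewrite nth_default // mul0r.
  by move: (ltn_ord i); rewrite ij ltnNge le_j.
move=> i _; rewrite exprMn -rmorphXn coefZ /= coefCM coefXn eq_sym.
by case: eqP => [->|]; rewrite ?mulr1 ?mulr0.
Qed.

Lemma collinearE :
  (collinear t1 = t3 + x1 * t1) * (collinear t2 = t3 + x1 * t2) * (collinear t3 = t3) *
  (collinear x1 = x3 + x2 * t1) * (collinear x2 = x3 + x2 * t2) * (collinear x3 = x3).
Proof. by rewrite /collinear !at_pointst !at_pointsx. Qed.

Lemma chartE : (chart t1 = (t1 - t3)%:P) * (chart t2 = (t2 - t3)%:P) * (chart t3 = t3%:P) *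
  (chart x1 = (t2 - t3)%:P * 'X) * (chart x2 = (x2 - x3)%:P * 'X) * (chart x3 = x3%:P).
Proof. by rewrite /chart !at_pointst !at_pointsx. Qed.

Lemma rescale_lin c a b :
  rescale c (a%:P + b%:P * 'X) = a%:P + b%:P * (c%:P * 'X).
Proof. by rewrite /rescale /= comp_polyD comp_polyM !comp_polyC comp_polyX. Qed.

(** Modulo the determinant, going to the line and back multiplies [p_1 - p_3] and
    [p_2 - p_3] by [(t2 - t3) 'X]; the only generator for which this is
    not an identity is [x1], where the difference is [cross * 'X]. *)
Lemma chart_collinear f :
  principal cross%:P (chart (collinear f) - rescale (t2 - t3) (contract predT 2%:R f)).
Proof.
have pI := @principal_ideal _ (cross%:P : {poly A}).
pose g1 : {rmorphism A -> {poly A}} := chart \o collinear.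
pose g2 : {rmorphism A -> {poly A}} := rescale (t2 - t3) \o contract predT 2%:R.
have chD a b c : chart (a + b * c) = chart a + chart b * chart c.
  by rewrite (rmorphD chart) (rmorphM chart).
have wit p q r : p = q + r * cross%:P -> principal cross%:P (p - q).
  by move=> ->; exists r; rewrite addrC addKr.
apply: (@rmorph_congr _ _ g1 g2 pI); rewrite /g1 /g2 /=.
- by move=> c; rewrite contractC /chart /collinear !at_pointsC /rescale comp_polyC.
- apply: ord3P; apply: (wit _ _ 0);
    by rewrite collinearE contractt ?chD !chartE rescale_lin ?subrr ?polyC0; ring.
apply: ord3P; rewrite collinearE contractx ?chD !chartE rescale_lin /=.
- by apply: (wit _ _ 'X); rewrite /cross !(polyCB, polyCM); ring.
- by apply: (wit _ _ 0); ring.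
by apply: (wit _ _ 0); rewrite subrr polyC0; ring.
Qed.

(** By [chart_collinear], [cross] divides [(t2 - t3)^j] times the part [c] of
    degree [j] of [f] for each [j], and it has no common factor with [t2 - t3]
    because it is not zero on [t2 = t3]. *)
Lemma collinear_ker f : collinear f = 0 -> principal cross f.
Proof.
move=> f0; have [q] := chart_collinear f.
rewrite f0 (rmorph0 chart) sub0r => qE.
rewrite -(contract1 predT 2%:R f) horner_coef.
apply: ideal_sum => [|j _]; first exact: principal_ideal.
rewrite expr1n mulr1; set c := _`_j.
have cE : cross * - q`_j = c * (t2 - t3) ^+ j.
  by rewrite -coef_rescale mulrN -coefCM mulrC -qE coefN opprK.
have ev : set_t 1 t3 cross != 0.
  apply: probe_neq0; rewrite /cross (rmorphB (set_t 1 t3)) !(rmorphM (set_t 1 t3)) /=.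
  rewrite !(rmorphB (set_t 1 t3)) /= !set_tt !set_tx /= subrr mul0r subr0.
  by rewrite (rmorphM probe) !(rmorphB probe) /= !probeE !subr0 mulr1.
have set0 : set_t 1 t3 (t2 - t3) = 0.
  by rewrite (rmorphB (set_t 1 t3)) /= !set_tt /= subrr.
have [d dE] := principal_pow_cancel (set_tP 1 t3) set0 ev cE.
have b0 : (t2 - t3) ^+ j != 0.
  rewrite expf_neq0 //; apply/eqP => /(congr1 (set_t 1 (t3 + 1))) /eqP.
  rewrite (rmorphB (set_t _ _)) (rmorph0 (set_t _ _)) /= !set_tt /=.
  by rewrite addrAC subrr add0r oner_eq0.
by exists d; apply: (mulIf b0); rewrite -cE dE mulrCA mulrA.
Qed.

(** * Lifting from the collinear triples *)

(** In the application [e] is a product of [N] linear forms in the positions; any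
    way of multiplying each of them by a coordinate [x1] or [x2] of the direction
    must come from [K]. *)
Definition lifts (K : set A) (e : A) (N : nat) :=
  forall i j, (i + j = N)%N -> exists2 f, K f & collinear f = x1 ^+ i * x2 ^+ j * e.

(** The [M] factors of [e] receive as many coordinates [x1] as are available, and
    those of [d] the remaining ones. *)
Lemma lifts_mul (I J K : set A) e d M N :
  (forall a b, I a -> J b -> K (a * b)) ->
  lifts I e M -> lifts J d N -> lifts K (e * d) (M + N).
Proof.
move=> IJK Ie Jd i j ij.
have /Ie[f If fE] : (minn i M + (M - minn i M) = M)%N by lia.
have /Jd[g Jg gE] : (i - minn i M + (j - (M - minn i M)) = N)%N by lia.
exists (f * g); first exact: IJK.
rewrite (rmorphM collinear) /= fE gE.
have iE : (i = minn i M + (i - minn i M))%N by lia.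
have jE : (j = M - minn i M + (j - (M - minn i M)))%N by lia.
by rewrite [in RHS]iE [in RHS]jE !exprD; ring.
Qed.

Lemma lifts_exp K e N n : lifts K e N -> lifts (ideal_pow K n) (e ^+ n) (n * N).
Proof.
move=> Ke; elim: n => [|n IHn]; last first.
  by rewrite exprS mulSn; apply: lifts_mul Ke IHn; apply: mem_ideal_mul.
by case=> [|i] // [|j] // _; exists 1; rewrite // rmorph1 !mul1r.
Qed.

Lemma lifts_diag k l e : collinear (t k - t l) = x1 * e -> collinear (x k - x l) = x2 * e ->
  lifts (diag_ideal R k l) e 1.
Proof.
move=> tE xE [|[|i]] [|[|j]] // _.
  by exists (x k - x l); [apply: mem_diag_x|rewrite xE mul1r].
by exists (t k - t l); [apply: mem_diag_t|rewrite tE mulr1].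
Qed.

Lemma lifts_01 : lifts (diag_ideal R 0 1) (t1 - t2) 1.
Proof. by apply: lifts_diag; rewrite (rmorphB collinear) /= !collinearE; ring. Qed.

Lemma lifts_02 : lifts (diag_ideal R 0 2%:R) t1 1.
Proof. by apply: lifts_diag; rewrite (rmorphB collinear) /= !collinearE; ring. Qed.

Lemma lifts_12 : lifts (diag_ideal R 1 2%:R) t2 1.
Proof. by apply: lifts_diag; rewrite (rmorphB collinear) /= !collinearE; ring. Qed.

Lemma lifts_sub (I K : set A) e N : I `<=` K -> lifts I e N -> lifts K e N.
Proof. by move=> IK Ie i j /Ie[f /IK Kf fE]; exists f. Qed.

Lemma big_I3 (S : Type) (idx : S) (op : Monoid.law idx) (F : 'I_3 -> S) :
  \big[op/idx]_(k < 3) F k = op (op (F 0) (F 1)) (F 2%:R).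
Proof.
rewrite !big_ord_recl big_ord0 Monoid.mulm1 Monoid.mulmA.
by congr (op (op (F _) (F _)) (F _)); apply: val_inj.
Qed.

(** Graduation by the weights [w]: the part of weight [j] is the coefficient of
    ['X^j]. *)
Definition weigh (w : 'I_(3 + 3) -> nat) : A -> {poly A} :=
  mmap (polyC \o @mpolyC _ _) (fun i => ('X_i)%:P * 'X^(w i)).
HB.instance Definition _ w := GRing.RMorphism.on (weigh w).

Definition weight (w : 'I_(3 + 3) -> nat) (m : 'X_{1..3 + 3}) := (\sum_i m i * w i)%N.

Lemma weigh_term w c m :
  weigh w (c *: 'X_[m]) = (c *: 'X_[m])%:P * 'X^(weight w m).
Proof.
rewrite /weigh mmapZ mmapX /= -mul_mpolyC polyCM -mulrA; congr (_ * _).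
rewrite /mmap1 mpolyXE_id (rmorph_prod polyC) /= /weight expr_sum -big_split /=.
by apply: eq_bigr => i _; rewrite exprMn polyC_exp -exprM mulnC.
Qed.

Lemma mcoeff_weigh w f m j :
  ((weigh w f)`_j)@_m = if j == weight w m then f@_m else 0.
Proof.
elim/mpolyind: f => [|c m' f _ _ IHf].
  by rewrite (rmorph0 (weigh w)) coef0 mcoeff0; case: ifP.
rewrite (rmorphD (weigh w)) [X in X + _]weigh_term coefD mcoeffD IHf.
rewrite coefCM coefXn [in RHS]mcoeffD.
have [->|jw] := eqVneq j (weight w m'); last first.
  rewrite mulr0 mcoeff0 add0r mcoeffZ mcoeffX; case: (eqVneq m' m) jw => [->|_ _].
    by move=> /negPf->.
  by rewrite mulr0 add0r.
rewrite mulr1 mcoeffZ mcoeffX; case: (eqVneq m' m) => [->|_]; first by rewrite eqxx.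
by rewrite !mulr0 !add0r.
Qed.

Lemma weigh_t w k : weigh w (t k) = (t k)%:P * 'X^(w (lshift 3 k)).
Proof. by rewrite /weigh /tvar mmapX mmap1U. Qed.

Lemma weigh_x w k : weigh w (x k) = (x k)%:P * 'X^(w (rshift 3 k)).
Proof. by rewrite /weigh /xvar mmapX mmap1U. Qed.

Lemma weighC w c : weigh w c%:MP = (c%:MP)%:P.
Proof. by rewrite /weigh mmapC. Qed.

(** The degrees in the positions [t1], [t2] and in the direction [x1], [x2]. *)
Definition tweight (i : 'I_(3 + 3)) : nat := (i < 2)%N.
Definition xweight (i : 'I_(3 + 3)) : nat := (3 <= i < 5)%N.

(** Positions and directions occur in [collinear] only through their products. *)
Lemma weigh_collinear f : weigh xweight (collinear f) = weigh tweight (collinear f).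
Proof.
have wD w a b c : weigh w (a + b * c) = weigh w a + weigh w b * weigh w c.
  by rewrite (rmorphD (weigh w)) (rmorphM (weigh w)).
elim/polytx_ind: f => [c|||f g fE gE|f g fE gE].
- by rewrite /collinear at_pointsC !weighC.
- by apply: ord3P; rewrite collinearE ?wD !weigh_t ?weigh_x /xweight /tweight /= ?expr0;
    ring.
- by apply: ord3P; rewrite collinearE ?wD ?weigh_t !weigh_x /xweight /tweight /= ?expr0;
    ring.
- by rewrite (rmorphD collinear) !(rmorphD (weigh _)) /= fE gE.
by rewrite (rmorphM collinear) !(rmorphM (weigh _)) /= fE gE.
Qed.

Lemma monomialE (m : 'X_{1..3 + 3}) :
  'X_[m] = t1 ^+ m (lshift 3 0) * t2 ^+ m (lshift 3 1) * t3 ^+ m (lshift 3 2%:R) *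
    (x1 ^+ m (rshift 3 0) * x2 ^+ m (rshift 3 1) * x3 ^+ m (rshift 3 2%:R)) :> A.
Proof. by rewrite mpolyXE_id big_split_ord /= !big_I3. Qed.

(** As [e] has degree [N] in the positions and [0] in the direction, [h] must have
    a degree in the direction larger by [N] than its degree in the positions.
    So each monomial of [h] has [N] coordinates of the direction for [e], and one
    for each of its own positions, which lift as elements of the unit ideal. *)
Lemma lifts_multiple K (e : A) N (f h : A) : is_ideal K -> lifts K e N -> e != 0 ->
  weigh xweight e = e%:P -> weigh tweight e = e%:P * 'X^N -> collinear f = h * e ->
  exists2 f0, K f0 & collinear f0 = collinear f.
Proof.
move=> KI Ke e0 ex et fE.
have wh : weigh xweight h = weigh tweight h * 'X^N.
  have := weigh_collinear f; rewrite fE !(rmorphM (weigh _)) /= ex et => whe.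
  by apply: (mulIf_shift _ whe); rewrite polyC_eq0.
have supp m : m \in msupp h -> weight xweight m = (N + weight tweight m)%N.
  rewrite mcoeff_msupp => hm; apply/eqP.
  have := mcoeff_weigh xweight h m (weight xweight m).
  rewrite wh coefMXn eqxx; case: ltnP => [_|Nw].
    by rewrite mcoeff0 => h0; rewrite -h0 eqxx in hm.
  rewrite mcoeff_weigh; case: eqP => [<- _|_ h0]; first by rewrite subnKC.
  by rewrite -h0 eqxx in hm.
rewrite fE [h]mpolyE big_seq.
elim/big_ind: _ => [|a b [f0 Kf0 aE] [g0 Kg0 bE]|m /supp].
- by exists 0; [exact: ideal0|rewrite mul0r (rmorph0 collinear)].
- by exists (f0 + g0); [exact: idealD|rewrite (rmorphD collinear) /= aE bE mulrDl].
rewrite /weight !big_split_ord /= !big_I3 /xweight /tweight /=.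
rewrite !(muln0, muln1, addn0, add0n) => wm.
have lT k (a : A) n : lifts (diag_ideal R k 2%:R) a 1 -> lifts setT (a ^+ n) n.
  by move=> la; have := lifts_exp (n := n) la; rewrite muln1; apply: lifts_sub.
have lt1 := lT _ _ (m (lshift 3 0)) lifts_02.
have lt2 := lT _ _ (m (lshift 3 1)) lifts_12.
have TT (a b : A) : [set: A] a -> [set: A] b -> [set: A] (a * b) by [].
have lt12 := lifts_mul TT lt1 lt2.
have KT (a b : A) : K a -> [set: A] b -> K (a * b).
  by move=> Ka _; rewrite mulrC; apply: idealMl.
have [f1 Kf1 f1E] := lifts_mul KT Ke lt12 wm.
exists ((h@_m)%:MP * t3 ^+ m (lshift 3 2%:R) * x3 ^+ m (rshift 3 2%:R) * f1).
  exact: idealMl.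
rewrite !(rmorphM collinear) !(rmorphXn collinear) /= f1E !collinearE /collinear at_pointsC.
by rewrite -mul_mpolyC monomialE; ring.
Qed.

(** * The image of the intersection of powers *)

Lemma collinear_pow_diag k l n e f :
  collinear (t k - t l) = x1 * e -> collinear (x k - x l) = x2 * e ->
  ideal_pow (diag_ideal R k l) n f -> principal (e ^+ n) (collinear f).
Proof.
have pI : is_ideal (collinear @^-1` principal e).
  by apply: ideal_preim; apply: principal_ideal.
move=> tE xE; have Ie : diag_ideal R k l `<=` collinear @^-1` principal e.
  by apply: (diag_ideal_min pI); [exists x1|exists x2].
exact: (@ideal_pow_principal _ _ collinear _ e n Ie f).
Qed.

Lemma tvar_neq0 k : t k != 0.
Proof.
apply/eqP => /(congr1 (set_t k 1)) /eqP.
by rewrite (rmorph0 (set_t _ _)) set_tt eqxx oner_eq0.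
Qed.

(** Divisibility by each of the powers of [t1 - t2], [t1], [t2] gives divisibility
    by their product, as these are coprime primes. *)
Lemma collinear_J m k f :
  J' R m (m + k) f -> principal (edge_factor t1 t2 m k) (collinear f).
Proof.
rewrite -edge_factorE => -[[/collinear_pow_diag f01 /collinear_pow_diag f02]].
move=> /collinear_pow_diag f12.
have [||u uE] := f01 (t1 - t2); try by rewrite (rmorphB collinear) /= !collinearE; ring.
have [||v vE] := f02 t1; try by rewrite (rmorphB collinear) /= !collinearE; ring.
have [||w wE] := f12 t2; try by rewrite (rmorphB collinear) /= !collinearE; ring.
have ev j f' : principal (t j) (f' - set_t j 0 f') by have := set_tP j 0 f'; rewrite subr0.
have ev0 j : set_t j 0 (t j) = 0 by rewrite set_tt eqxx.
have [u' u'E] : principal (t1 ^+ m) u.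
  apply: (principal_pow_cancel (ev 0) (ev0 0) (c := (t1 - t2) ^+ m) (h := v)).
    rewrite (rmorphXn (set_t _ _)) (rmorphB (set_t _ _)) /= !set_tt /= sub0r.
    by rewrite expf_neq0 // oppr_eq0 tvar_neq0.
  by rewrite mulrC -uE; exact: vE.
have [u'' u''E] : principal (t2 ^+ (m + k)) u'.
  apply: (principal_pow_cancel (ev 1) (ev0 1) (c := t1 ^+ m * (t1 - t2) ^+ m) (h := w)).
    rewrite (rmorphM (set_t _ _)) !(rmorphXn (set_t _ _)).
    rewrite (rmorphB (set_t _ _)) /= !set_tt /=.
    by rewrite subr0 mulf_neq0 // expf_neq0 // tvar_neq0.
  by rewrite -wE uE u'E; ring.
by exists u''; rewrite uE u'E u''E; ring.
Qed.

Lemma edge_factor_neq0 m k : edge_factor t1 t2 m k != 0.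
Proof.
have t12 : t1 - t2 != 0 by apply: probe_neq0; rewrite (rmorphB probe) /= !probeE subr0.
by rewrite mulf_neq0 // expf_neq0 ?mulf_neq0 ?tvar_neq0.
Qed.

Lemma xweigh_edge_factor m k :
  weigh xweight (edge_factor t1 t2 m k) = (edge_factor t1 t2 m k)%:P.
Proof.
rewrite (rmorph_edge_factor (weigh xweight)) /= !weigh_t /xweight /= !expr0 !mulr1.
exact: esym (rmorph_edge_factor polyC _ _ _ _).
Qed.

Lemma tweigh_edge_factor m k :
  weigh tweight (edge_factor t1 t2 m k) = (edge_factor t1 t2 m k)%:P * 'X^(m * 3 + k).
Proof.
rewrite (rmorph_edge_factor (weigh tweight)) /= !weigh_t /tweight /= !expr1.
by rewrite edge_factor_scale -(rmorph_edge_factor polyC).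
Qed.

(** * The product decomposition *)

Lemma mem_J11 f : J' R 1 1 f <->
  [/\ diag_ideal R 0 1 f, diag_ideal R 0 2%:R f & diag_ideal R 1 2%:R f].
Proof.
rewrite /J' !(ideal_pow1 (diag_ideal_ideal _ _)).
by split=> [[[]]|[]] //; split.
Qed.

Lemma J01 : J' R 0 1 = diag_ideal R 1 2%:R.
Proof. by rewrite /J' (ideal_pow1 (diag_ideal_ideal _ _)) !setTI. Qed.

Lemma J_ideal m n : is_ideal (J' R m n).
Proof. by do 2?apply: ideal_setI; apply: ideal_pow_ideal. Qed.

(** The product of the three diagonal ideals is enough for the lifting. *)
Lemma lifts_J11 : lifts (J' R 1 1) ((t1 - t2) * t1 * t2) 3.
Proof.
have I01 := diag_ideal_ideal 0 1.
have I02 := diag_ideal_ideal 0 2%:R.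
have I12 := diag_ideal_ideal 1 2%:R.
have cap (a b : A) : diag_ideal R 0 1 a -> diag_ideal R 0 2%:R b ->
    (diag_ideal R 0 1 `&` diag_ideal R 0 2%:R) (a * b).
  by move=> Ia Ib; split; [rewrite mulrC; apply: (idealMl _ I01)|apply: (idealMl _ I02)].
apply: (lifts_mul _ (lifts_mul cap lifts_01 lifts_02) lifts_12) => a b [Ia Ja] Kb.
apply/mem_J11; split; last exact: (idealMl _ I12).
  by rewrite mulrC; apply: (idealMl _ I01).
by rewrite mulrC; apply: (idealMl _ I02).
Qed.

Lemma product_sub_J m k :
  ideal_mul (ideal_pow (J' R 1 1) m) (ideal_pow (diag_ideal R 1 2%:R) k)
    `<=` J' R m (m + k).
Proof.
have pow (I : set A) (a : A) : (forall f, J' R 1 1 f -> I f) -> ideal_pow (J' R 1 1) m a ->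
  ideal_pow I m a by move=> JI; apply: ideal_pow_mono.
apply: ideal_mul_min => [|a b Ja Ib]; first exact: J_ideal.
have a01 : ideal_pow (diag_ideal R 0 1) m a by apply: pow Ja => f /mem_J11[].
have a02 : ideal_pow (diag_ideal R 0 2%:R) m a by apply: pow Ja => f /mem_J11[].
have a12 : ideal_pow (diag_ideal R 1 2%:R) m a by apply: pow Ja => f /mem_J11[].
split; last exact: ideal_powD.
by split; rewrite mulrC; apply: (idealMl _ (ideal_pow_ideal _ _)).
Qed.

(** Induction on [m]: an element is the sum of a lift of its restriction to
    collinear triples and of a multiple of [cross], whose cofactor has orders
    of vanishing lower by one. *)
Lemma J_sub_product m k :
  J' R m (m + k) `<=`
    ideal_mul (ideal_pow (J' R 1 1) m) (ideal_pow (diag_ideal R 1 2%:R) k).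
Proof.
elim: m => [|m IHm] f Jf.
  by rewrite -[f]mul1r; apply: mem_ideal_mul => //; case: Jf.
have [h fE] := collinear_J Jf.
set K := ideal_mul _ _; have KI : is_ideal K by apply: ideal_mul_ideal.
have Ke : lifts K (edge_factor t1 t2 m.+1 k) (m.+1 * 3 + k).
  have lk := lifts_exp (n := k) lifts_12; rewrite muln1 in lk.
  by apply: lifts_mul (lifts_exp lifts_J11) lk; apply: mem_ideal_mul.
have [f0 Kf0 f0E] : exists2 f0, K f0 & collinear f0 = collinear f.
  apply: (lifts_multiple KI Ke _ _ _ fE); first exact: edge_factor_neq0.
    exact: xweigh_edge_factor.
  exact: tweigh_edge_factor.
have [g gE] : principal cross (f - f0).
  by apply: collinear_ker; rewrite (rmorphB collinear) /= f0E subrr.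
have Jg : J' R m (m + k) g.
  have Jcg : J' R m.+1 (m.+1 + k) (cross * g).
    rewrite mulrC -gE; apply: (idealB (J_ideal _ _) Jf).
    exact: product_sub_J.
  case: Jcg => -[g01 g02] g12; split; last exact: (diag_pow_cross _ g12).
  by split; [exact: (diag_pow_cross _ g01)|exact: (diag_pow_cross _ g02)].
(* The cofactor [g] is in the product for the exponent [m], and [cross] supplies
   the missing factor in [J'(1,1)]. *)
suff Kcross : J' R m (m + k) `<=` [set a | K (a * cross)].
  by rewrite -(subrK f0 f) gE; apply: (idealD KI) => //; apply: Kcross.
move=> a /IHm; move: a; apply: ideal_mul_min => [|a b Ja Ib /=].
  exact: ideal_colon.
rewrite mulrC mulrA; apply: mem_ideal_mul => //; apply: mem_ideal_mul => //.
by apply/mem_J11; split; apply: cross_diag.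
Qed.
End Points.

Theorem theorem1p14 (R : realType) (d1 d2 : nat) (hd : (d1 <= d2)%N) :
  J' R d1 d2 = ideal_mul (ideal_pow (J' R 1 1) d1) (ideal_pow (J' R 0 1) (d2 - d1)%N).
Proof.
rewrite -{1}(subnKC hd) J01; apply/seteqP; split; first exact: J_sub_product.
exact: product_sub_J.
Qed.
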